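(* Let $X$ be any non-empty set, let $G$ be a gyrogroup and let $M(G)$ be its Grothendieck group completion. Then there is a one-to-one correspondence between the set of all gyrogroup actions of $G$ on $X$ and the set of all group actions of $M(G)$ on $X$.
   Context: A gyrogroup is a non-empty set $G$ with a binary operation $\circ$ such that: (1) there is $e\in G$ with $e\circ a=a$ for all $a\in G$; (2) for each $a\in G$ there is $a^{-1}\in G$ with $a^{-1}\circ a=e$; (3) for all $a,b\in G$ there is an automorphism $\mathrm{gyr}[a,b]$ of $(G,\circ)$ with $a\circ(b\circ c)=(a\circ b)\circ \mathrm{gyr}[a,b]c$ for all $c\in G$; (4) $\mathrm{gyr}[a\circ b,b]=\mathrm{gyr}[a,b]$ for all $a,b\in G$. A gyrogroup action of $G$ on a set $X$ is a map $*:G\times X\to X$ with $e*x=x$ and $(a\circ b)*x=a*(b*x)$ for all $a,b\in G$, $x\in X$; equivalently, a gyrogroup homomorphism $\eta:G\to\mathrm{Sym}(X)$, i.e. a map with $\eta(a\circ b)=\eta(a)\eta(b)$. Grothendieck group completion. Put $G^*=G\setminus\{e\}$. Each $f\in \mathrm{Sym}(G^* )$ is regarded as a permutation of $G$ by setting $f(e)=e$. For $f\in\mathrm{Sym}(G^* )$ and $a\in G$, let $\sigma_a(f)\in\mathrm{Sym}(G^* )$ be defined by $f(a)\circ\sigma_a(f)(b)=f(a\circ b)$. The set $G\times\mathrm{Sym}(G^* )$ is a group under $(a,f)\cdot(b,g)=(a\circ f(b),\ \mathrm{gyr}[a,f(b)]\,\sigma_b(f)\,g)$, with identity $(e,I)$,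 where $I$ is the identity map. Let $R(G)\le \mathrm{Sym}(G^* )$ be the subgroup generated by all $\mathrm{gyr}[a,b]$, $a,b\in G$, identified with $\{e\}\times R(G)$, and identify $a \in G$ with $(a,I)$. The subgroup generated by $G\times\{I\}$ is $G R(G):=G\times R(G)$. Let $[R(G)]$ be the smallest normal subgroup of $GR(G)$ containing $\{e\}\times R(G)$. Put $M(G)=GR(G)/[R(G)]$ and $\nu:G\to M(G)$, $\nu(a)=(a,I)[R(G)]$. The pair $(M(G),\nu)$ is the Grothendieck group completion of $G$. *)

(* Defs.v *)
From HB Require Import structures.
From mathcomp Require Import all_boot.
From mathcomp Require Import boolp.

Set Implicit Arguments.
Unset Strict Implicit.
Unset Printing Implicit Defensive.

Local Open Scope group_scope.
Local Open Scope quotient_scope.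

(* No [choiceType] requirement: the carrier is an arbitrary type, possibly
   infinite.  Identity and inverse are operations of [BaseGroup]; only their
   left laws are assumed. *)
HB.mixin Record BaseGroup_isGyrogroup G of BaseGroup G := {
  gyr : G -> G -> G -> G;
  gyr_mul1g : left_id (1 : G) *%g;
  gyr_mulVg : left_inverse (1 : G) inv *%g;
  gyr_bij : forall a b : G, bijective (gyr a b);
  gyrM : forall a b : G, {morph gyr a b : x y / x * y};
  gyr_mulA : forall a b c : G, a * (b * c) = (a * b) * gyr a b c;
  gyr_loop : forall a b : G, gyr (a * b) b = gyr a b
}.

#[short(type="gyrogroupType")]
HB.structure Definition Gyrogroup :=
  { G of BaseGroup_isGyrogroup G & BaseGroup G }.

(* An action only involves the identity and the product, so the same record
   gives gyrogroup actions (on a [gyrogroupType]) and group actions (on a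
   [groupType]). *)
Record action (G : baseUMagmaType) (X : Type) := Action {
  act :> G -> X -> X;
  act1 : forall x, act 1 x = x;
  actM : forall a b x, act (a * b) x = act a (act b x)
}.

Section GyrogroupTheory.
Variable G : gyrogroupType.
Implicit Types a b c : G.

Lemma gyr_mulI a : injective (mul a).
Proof.
move=> b c /(congr1 (mul a^-1)); rewrite !gyr_mulA gyr_mulVg !gyr_mul1g.
exact/bij_inj/gyr_bij.
Qed.

Lemma gyr1g b c : gyr 1 b c = c.
Proof. by apply: (@gyr_mulI b); rewrite -{1}[b]gyr_mul1g -gyr_mulA gyr_mul1g. Qed.

Lemma gyr_mulKg a b : a^-1 * (a * b) = b.
Proof.
by rewrite gyr_mulA -gyr_loop gyr_mulVg gyr1g gyr_mul1g.
Qed.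

Lemma gyr_mulg1 a : a * 1 = a.
Proof. by apply: (@gyr_mulI a^-1); rewrite gyr_mulKg gyr_mulVg. Qed.

Lemma gyr_mulgV a : a * a^-1 = 1.
Proof. by apply: (@gyr_mulI a^-1); rewrite gyr_mulKg gyr_mulg1. Qed.

Lemma gyr_invgK a : a^-1^-1 = a.
Proof. by apply: (@gyr_mulI a^-1); rewrite gyr_mulgV gyr_mulVg. Qed.

Lemma gyr_mulVKg a b : a * (a^-1 * b) = b.
Proof. by rewrite -{1}[a]gyr_invgK gyr_mulKg. Qed.

Lemma gyrg1 a b : gyr a b 1 = 1.
Proof.
apply: (@gyr_mulI (gyr a b 1)).
by rewrite -gyrM gyr_mul1g gyr_mulg1.
Qed.

Lemma gyrg_1 a c : gyr a 1 c = c.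
Proof.
by apply: (@gyr_mulI (a * 1)); rewrite -gyr_mulA gyr_mul1g gyr_mulg1.
Qed.

End GyrogroupTheory.

(* Permutations of G \ {1}, represented as permutations of G fixing 1. *)
Record symstar (G : gyrogroupType) := SymStar {
  sfun :> G -> G;
  sfun_bij : bijective sfun;
  sfun1 : sfun 1 = 1
}.

HB.instance Definition _ G := gen_eqMixin (symstar G).
HB.instance Definition _ G := gen_choiceMixin (symstar G).

Section SymStarGroup.
Variable G : gyrogroupType.
Implicit Types f g h : symstar G.

Lemma symstarP f g : f =1 g -> f = g.
Proof.
case: f g => [f fb f1] [g gb g1] /= /funext eq_fg.
by subst g; congr SymStar; exact: Prop_irrelevance.
Qed.

Definition symstar_one := @SymStar G id (Bijective (fun=> erefl) (fun=> erefl)) erefl.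

Lemma symstar_mul1 f g : (f \o g) 1 = 1.
Proof. by rewrite /= !sfun1. Qed.

Definition symstar_mul f g :=
  SymStar (bij_comp (sfun_bij f) (sfun_bij g)) (symstar_mul1 f g).

Lemma symstar_inv_ex f : exists g : G -> G, cancel f g /\ cancel g f.
Proof. by case: (sfun_bij f) => g fK gK; exists g. Qed.

Definition symstar_inv_fun f : G -> G := sval (cid (symstar_inv_ex f)).

Lemma symstar_invK f : cancel f (symstar_inv_fun f).
Proof. by rewrite /symstar_inv_fun; case: cid => g []. Qed.

Lemma symstar_invKV f : cancel (symstar_inv_fun f) f.
Proof. by rewrite /symstar_inv_fun; case: cid => g []. Qed.

Lemma symstar_inv1 f : symstar_inv_fun f 1 = 1.
Proof. by rewrite -{1}(sfun1 f) symstar_invK. Qed.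

Definition symstar_inv f :=
  SymStar (Bijective (symstar_invKV f) (symstar_invK f)) (symstar_inv1 f).

Lemma symstar_mulA : associative symstar_mul.
Proof. by move=> f g h; exact: symstarP. Qed.
Lemma symstar_mul1g : left_id symstar_one symstar_mul.
Proof. by move=> f; exact: symstarP. Qed.
Lemma symstar_mulg1 : right_id symstar_one symstar_mul.
Proof. by move=> f; exact: symstarP. Qed.
Lemma symstar_mulVg : left_inverse symstar_one symstar_inv symstar_mul.
Proof. by move=> f; apply: symstarP => x /=; rewrite symstar_invK. Qed.
Lemma symstar_mulgV : right_inverse symstar_one symstar_inv symstar_mul.
Proof. by move=> f; apply: symstarP => x /=; rewrite symstar_invKV. Qed.

HB.instance Definition _ := isGroup.Build (symstar G)
  symstar_mulA symstar_mul1g symstar_mulg1 symstar_mulVg symstar_mulgV.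

Lemma symstar1E x : (1 : symstar G) x = x. Proof. by []. Qed.
Lemma symstarME f g x : (f * g) x = f (g x). Proof. by []. Qed.
Lemma symstarK f : cancel f f^-1. Proof. exact: symstar_invK. Qed.
Lemma symstarKV f : cancel f^-1 f. Proof. exact: symstar_invKV. Qed.

Definition gyrs (a b : G) := SymStar (gyr_bij a b) (gyrg1 a b).

(* Characterized by [sigmaE]. *)
Definition sigma_fun (a : G) f (b : G) : G := (f a)^-1 * f (a * b).

Lemma sigma_bij a f : bijective (sigma_fun a f).
Proof.
exists (fun b => a^-1 * f^-1 (f a * b)) => b; rewrite /sigma_fun.
  by rewrite gyr_mulVKg symstarK gyr_mulKg.
by rewrite gyr_mulVKg symstarKV gyr_mulKg.
Qed.

Lemma sigma_fun1 a f : sigma_fun a f 1 = 1.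
Proof. by rewrite /sigma_fun gyr_mulg1 gyr_mulVg. Qed.

Definition sigma a f := SymStar (sigma_bij a f) (sigma_fun1 a f).

Lemma sigmaE a f b : f a * sigma a f b = f (a * b).
Proof. exact: gyr_mulVKg. Qed.

End SymStarGroup.

(* G x Sym(G \ {1}).  A fresh record rather than [prod], which carries the
   componentwise product. *)
Record gsym (G : gyrogroupType) := GSym { gs1 : G; gs2 : symstar G }.

HB.instance Definition _ G := gen_eqMixin (gsym G).
HB.instance Definition _ G := gen_choiceMixin (gsym G).

Section GSymGroup.
Variable G : gyrogroupType.
Implicit Types p q r : gsym G.

Definition gsym_one : gsym G := GSym 1 1.

Definition gsym_mul p q : gsym G :=
  GSym (gs1 p * gs2 p (gs1 q))
       (gyrs (gs1 p) (gs2 p (gs1 q)) * sigma (gs1 q) (gs2 p) * gs2 q).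

Definition gsym_inv p : gsym G :=
  let b := (gs2 p)^-1 (gs1 p)^-1 in
  GSym b (gyrs (gs1 p) (gs2 p b) * sigma b (gs2 p))^-1.

(* (a, f) stands for the permutation x |-> a * f x of G. *)
Definition gsym_fun p (x : G) := gs1 p * gs2 p x.

Lemma gsym_fun_inj p q : gsym_fun p =1 gsym_fun q -> p = q.
Proof.
case: p q => [a f] [b g] eq_pq.
have eq_ab : a = b by have := eq_pq 1; rewrite /gsym_fun /= !sfun1 !gyr_mulg1.
subst b; congr GSym; apply: symstarP => x.
exact: (gyr_mulI (eq_pq x)).
Qed.

Lemma gsym_funM p q x : gsym_fun (gsym_mul p q) x = gsym_fun p (gsym_fun q x).
Proof.
by rewrite /gsym_fun /= -gyr_mulA /sigma_fun gyr_mulVKg.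
Qed.

Lemma gsym_mulA : associative gsym_mul.
Proof. by move=> p q r; apply: gsym_fun_inj => x; rewrite !gsym_funM. Qed.

Lemma gsym_mul1g : left_id gsym_one gsym_mul.
Proof.
move=> p; apply: gsym_fun_inj => x.
by rewrite gsym_funM /gsym_fun /= gyr_mul1g.
Qed.

Lemma gsym_mulg1 : right_id gsym_one gsym_mul.
Proof.
move=> p; apply: gsym_fun_inj => x.
by rewrite gsym_funM /gsym_fun /= gyr_mul1g.
Qed.

Lemma gsym_mulgV : right_inverse gsym_one gsym_inv gsym_mul.
Proof.
move=> p; rewrite /gsym_mul /gsym_inv /gsym_one /= mulgV symstarKV.
by rewrite gyr_mulgV.
Qed.

Lemma gsym_mulVg : left_inverse gsym_one gsym_inv gsym_mul.
Proof.
move=> p; rewrite -{2}[p]gsym_mulg1 -(gsym_mulgV (gsym_inv p)).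
by rewrite [gsym_mul p _]gsym_mulA gsym_mulgV gsym_mul1g gsym_mulgV.
Qed.

HB.instance Definition _ := isGroup.Build (gsym G)
  gsym_mulA gsym_mul1g gsym_mulg1 gsym_mulVg gsym_mulgV.

Lemma gsymME (a b : G) (f g : symstar G) :
  GSym a f * GSym b g = GSym (a * f b) (gyrs a (f b) * sigma b f * g).
Proof. by []. Qed.

End GSymGroup.

(* Subgroups, generation, normal closures and quotients for groups that need
   not be finite. *)
Section Subgroups.
Variable T : groupType.
Implicit Types S H : {pred T}.

Definition generated S : {pred T} :=
  [pred x | `[< forall H, group_closed H -> {subset S <= H} -> x \in H >]].

Lemma sub_generated S : {subset S <= generated S}.
Proof. by move=> x xS; apply/asboolP => H _; exact. Qed.

Lemma generated_min S H :
  group_closed H -> {subset S <= H} -> {subset generated S <= H}.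
Proof. by move=> gH SH x /asboolP; exact. Qed.

Lemma generated_closed S : group_closed (generated S).
Proof.
split=> [|x y /asboolP Sx /asboolP Sy]; apply/asboolP => H gH SH.
  by case: gH.
by case: (gH) => _; apply; [exact: Sx | exact: Sy].
Qed.

Definition normal_closed H := {in H, forall x y, x ^ y \in H}.

Record normal_subgroup := NormalSubgroup {
  nsub :> {pred T};
  nsub_group : group_closed nsub;
  nsub_normal : normal_closed nsub
}.

Definition normal_closure_pred S : {pred T} :=
  [pred x | `[< forall H, group_closed H -> normal_closed H ->
                  {subset S <= H} -> x \in H >]].

Lemma sub_normal_closure S : {subset S <= normal_closure_pred S}.
Proof. by move=> x xS; apply/asboolP => H _ _; exact. Qed.

Lemma normal_closure_group S : group_closed (normal_closure_pred S).
Proof.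
split=> [|x y /asboolP Sx /asboolP Sy]; apply/asboolP => H gH nH SH.
  by case: gH.
by case: (gH) => _; apply; [exact: Sx | exact: Sy].
Qed.

Lemma normal_closure_normal S : normal_closed (normal_closure_pred S).
Proof.
move=> x /asboolP Sx y; apply/asboolP => H gH nH SH.
by apply: (nH); exact: Sx.
Qed.

Definition normal_closure S :=
  NormalSubgroup (@normal_closure_group S) (@normal_closure_normal S).

End Subgroups.

Section Quotient.
Variables (T : groupType) (N : normal_subgroup T).
Implicit Types x y z : T.

Definition coset_rel : rel T := fun x y => x^-1 * y \in (N : {pred T}).

Lemma coset_equiv : equiv_class_of coset_rel.
Proof.
have [N1 _] := nsub_group N.
split=> [x | x y | y x z]; rewrite /coset_rel.
- by rewrite mulVg.
- by apply/idP/idP=> /(group_closedV (nsub_group N)); rewrite invgM invgK.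
- move=> xy yz.
  by have := group_closedM (nsub_group N) xy yz; rewrite mulgA mulgK.
Qed.

Canonical coset_equiv_rel := EquivRelPack coset_equiv.

Definition quot := {eq_quot coset_equiv_rel}.
HB.instance Definition _ := Choice.on quot.
HB.instance Definition _ := EqQuotient.on quot.

Lemma quot_eqP x y :
  reflect (\pi_quot x = \pi_quot y) (x^-1 * y \in (N : {pred T})).
Proof. exact: (@eqquotP T coset_equiv_rel quot). Qed.

Definition quot_one : quot := \pi_quot 1.
Definition quot_mul : quot -> quot -> quot := lift_op2 quot *%g.
Definition quot_inv : quot -> quot := lift_op1 quot inv.

Lemma quot_mulE x y : quot_mul (\pi_quot x) (\pi_quot y) = \pi_quot (x * y).
Proof.
rewrite /quot_mul -lock; apply/quot_eqP.
have /quot_eqP := reprK (\pi_quot y); have /quot_eqP := reprK (\pi_quot x).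
set x' := repr _; set y' := repr _; move=> Nx Ny.
have := group_closedM (nsub_group N) (nsub_normal Nx y') Ny.
by rewrite /conjg !invgM !mulgA mulgK.
Qed.

Lemma quot_invE x : quot_inv (\pi_quot x) = \pi_quot x^-1.
Proof.
rewrite /quot_inv -lock; apply/quot_eqP.
have /quot_eqP := reprK (\pi_quot x); set x' := repr _.
rewrite invgK => /(group_closedV (nsub_group N)).
rewrite invgM invgK => Nx.
have := nsub_normal Nx x^-1; by rewrite /conjg invgK !mulgA mulgV mul1g.
Qed.

Lemma quot_mulA : associative quot_mul.
Proof.
by elim/quotW=> x; elim/quotW=> y; elim/quotW=> z; rewrite !quot_mulE mulgA.
Qed.
Lemma quot_mul1g : left_id quot_one quot_mul.
Proof. by elim/quotW=> x; rewrite quot_mulE mul1g. Qed.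
Lemma quot_mulg1 : right_id quot_one quot_mul.
Proof. by elim/quotW=> x; rewrite quot_mulE mulg1. Qed.
Lemma quot_mulVg : left_inverse quot_one quot_inv quot_mul.
Proof. by elim/quotW=> x; rewrite quot_invE quot_mulE mulVg. Qed.
Lemma quot_mulgV : right_inverse quot_one quot_inv quot_mul.
Proof. by elim/quotW=> x; rewrite quot_invE quot_mulE mulgV. Qed.

HB.instance Definition _ := isGroup.Build quot
  quot_mulA quot_mul1g quot_mulg1 quot_mulVg quot_mulgV.

End Quotient.

Section Completion.
Variable G : gyrogroupType.

(* R(G) *)
Definition gyr_subgroup : {pred symstar G} :=
  generated [pred f | `[< exists a b : G, f = gyrs a b >]].

Definition GR_pred : {pred gsym G} := [pred p | gs2 p \in gyr_subgroup].

Lemma gyrs_in a b : gyrs a b \in gyr_subgroup.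
Proof. by apply: sub_generated; apply/asboolP; exists a, b. Qed.

Lemma gyr_subgroup1 : 1 \in gyr_subgroup.
Proof. by case: (generated_closed [pred f | `[< exists a b : G, f = gyrs a b >]]). Qed.

Lemma gyr_subgroupM : mulg_closed gyr_subgroup.
Proof. exact/group_closedM/generated_closed. Qed.

Lemma gyr_subgroupV : invg_closed gyr_subgroup.
Proof. exact/group_closedV/generated_closed. Qed.

Lemma gyr_subgroup_morph f : f \in gyr_subgroup -> {morph f : x y / x * y}.
Proof.
pose H : {pred symstar G} := [pred f | `[< {morph sfun f : x y / x * y} >]].
move=> Rf; suff /asboolP : f \in H by [].
apply: generated_min Rf => [|g /asboolP[a [b ->]]]; last first.
  by apply/asboolP; exact: gyrM.
split=> [|g h /asboolP gM /asboolP hM]; apply/asboolP => // x y.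
rewrite !symstarME -gM; congr (g _).
by apply: (can_inj (symstarK h)); rewrite hM !symstarKV.
Qed.

Lemma sigma_gyr_subgroup b f : f \in gyr_subgroup -> sigma b f = f.
Proof.
move=> /gyr_subgroup_morph fM; apply: symstarP => x.
by apply: (@gyr_mulI _ (f b)); rewrite sigmaE fM.
Qed.

Lemma GR_closed : group_closed GR_pred.
Proof.
split=> [|p q Rp Rq]; first exact: gyr_subgroup1.
have RM r s : r \in GR_pred -> s \in GR_pred -> r * s \in GR_pred.
  move=> Rr Rs; apply: (gyr_subgroupM _ Rs).
  by rewrite sigma_gyr_subgroup //; exact: (gyr_subgroupM (gyrs_in _ _)).
apply: RM => //; apply: gyr_subgroupV.
by rewrite sigma_gyr_subgroup //; exact: (gyr_subgroupM (gyrs_in _ _)).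
Qed.

Definition GR := {p : gsym G | p \in GR_pred}.
HB.instance Definition _ := SubChoice.on GR.
HB.instance Definition _ := SubChoice_isSubGroup.Build _ _ GR GR_closed.

Definition GR_incl (a : G) : GR := exist _ (GSym a 1) gyr_subgroup1.

Lemma GR_generated : GR_pred =i generated [pred p | gs2 p == 1].
Proof.
set S := [pred p | _]; have gS := generated_closed S.
have gSM := group_closedM gS.
have inS a : GSym a 1 \in generated S.
  by apply: sub_generated; rewrite inE.
have mul1s (a : G) f : GSym a 1 * GSym 1 f = GSym a f.
  rewrite gsymME; congr GSym; first exact: gyr_mulg1.
  apply: symstarP => x /=.
  by rewrite gyrg_1 /sigma_fun /= gyr_mulKg.
move=> p; apply/idP/idP; last first.
  apply: (generated_min GR_closed) => {}p /eqP p1.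
  by rewrite /GR_pred inE p1 gyr_subgroup1.
case: p => a f Rf; rewrite -mul1s; apply/gSM => //.
pose K : {pred symstar G} := [pred f | GSym 1 f \in generated S].
have Kmul (g h : symstar G) : GSym 1 g * GSym 1 h = GSym 1 (g * h).
  rewrite gsymME sfun1 gyr_mul1g; congr GSym; apply: symstarP => x /=.
  rewrite gyr1g /sigma_fun sfun1 gyr_mul1g.
  by rewrite -[in LHS](gyr_mul1g (g (h x))) gyr_mulKg.
suff : f \in K by [].
apply: generated_min Rf => [|g /asboolP[b [c ->]]].
  split=> [|g h Kg Kh]; first exact: inS.
  have Vh : (GSym 1 h)^-1 = GSym 1 h^-1.
    by apply: (mulg1_eq (G := gsym G)); rewrite Kmul mulgV.
  by rewrite inE -Kmul -Vh; apply: (gS).2.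
have eqK : GSym 1 (gyrs b c) = (GSym (b * c) 1)^-1 * (GSym b 1 * GSym c 1).
  apply: (mulgI (GSym (b * c) 1)); rewrite mulVKg.
  rewrite mul1s gsymME; congr GSym; apply: symstarP => x /=.
  by rewrite /sigma_fun /= gyr_mulKg.
by rewrite inE eqK; apply/gSM; [exact/(group_closedV gS) | exact/gSM].
Qed.

(* [R(G)] *)
Definition R_closure : normal_subgroup GR :=
  normal_closure [pred p : GR | `[< gs1 (val p) = 1 >]].

(* M(G) *)
Definition completion : groupType := quot R_closure.

Definition nu (a : G) : completion := \pi_(quot R_closure) (GR_incl a).

End Completion.

(* Main.v *)
Require Import Defs.
From mathcomp Require Import all_boot.
From mathcomp Require Import boolp.

(** The value of a gyrogroup action at [c] does not change when a gyration is
    applied to [c]: compare [a (b c)] with [(a b) (gyr[a,b] c)] and cancel.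
    Hence [(a, f) |-> alpha a] is an action of [GR(G)] that is trivial on
    [[R(G)]], so it descends to [M(G)].  Conversely an action of [M(G)] is
    pulled back along [nu], which is multiplicative and surjective because
    [(a, f)] and [(a, I)] always lie in the same coset of [[R(G)]]. *)

Set Implicit Arguments.
Unset Strict Implicit.
Unset Printing Implicit Defensive.

Local Open Scope group_scope.
Local Open Scope quotient_scope.

Lemma actionP (G : baseUMagmaType) (X : Type) (alpha beta : action G X) :
  (forall a x, alpha a x = beta a x) -> alpha = beta.
Proof.
case: alpha beta => [f f1 fM] [g g1 gM] /= eq_fg.
have eqf : f = g by apply/funext => a; apply/funext.
by subst g; congr Action; exact: Prop_irrelevance.
Qed.

Section QuotientAction.
Variables (T : groupType) (X : Type).

Lemma actK (alpha : action T X) a : cancel (alpha a) (alpha a^-1).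
Proof. by move=> x; rewrite -actM mulVg act1. Qed.

Definition act_kernel (alpha : action T X) : {pred T} :=
  [pred a | `[< forall x, alpha a x = x >]].

Lemma act_kernel_group alpha : group_closed (act_kernel alpha).
Proof.
split=> [|a b /asboolP Ka /asboolP Kb]; apply/asboolP => x; first exact: act1.
by rewrite actM -{1}(Kb x) actK.
Qed.

Lemma act_kernel_normal alpha : normal_closed (act_kernel alpha).
Proof.
by move=> a /asboolP Ka b; apply/asboolP => x; rewrite /conjg !actM Ka actK.
Qed.

(** The kernel of an action is itself a normal subgroup, so minimality of the normal closure
    applies. *)
Lemma normal_closure_act_kernel alpha (S : {pred T}) :
  {subset S <= act_kernel alpha} ->
  {subset (normal_closure S : {pred T}) <= act_kernel alpha}.
Proof.
move=> SK x /asboolP.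
by apply; [exact: act_kernel_group | exact: act_kernel_normal |].
Qed.

Lemma quot_action_ex (N : normal_subgroup T) alpha :
  {subset (N : {pred T}) <= act_kernel alpha} ->
  exists beta : action (quot N) X,
    forall a x, beta (\pi_(quot N) a) x = alpha a x.
Proof.
move=> NK; pose f (m : quot N) := alpha (repr m).
have fE a x : f (\pi_(quot N) a) x = alpha a x.
  (* The chosen representative is [a] times an element of [N], which acts trivially. *)
  have /quot_eqP/NK/asboolP Ka := esym (reprK (\pi_(quot N) a)).
  by rewrite -{2}(Ka x) -actM mulgA mulgV mul1g.
have f1 x : f 1 x = x by rewrite fE act1.
have fM m n x : f (m * n) x = f m (f n x).
  by elim/quotW: m => a; elim/quotW: n => b; rewrite [_ * _]quot_mulE !fE actM.
by exists (Action f1 fM).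
Qed.

End QuotientAction.

Section CompletionAction.
Variables (G : gyrogroupType) (X : Type).

Lemma act_gyr (alpha : action G X) a b c x : alpha (gyr a b c) x = alpha c x.
Proof.
have alpha_inj d : injective (alpha d).
  by apply: (@can_inj _ _ _ (alpha d^-1)) => y; rewrite -actM gyr_mulVg act1.
by apply: (alpha_inj (a * b)); rewrite -actM -gyr_mulA !actM.
Qed.

(** The permutations that [alpha] cannot detect form a subgroup containing every gyration, hence all
    of R(G). *)
Lemma act_gyr_subgroup (alpha : action G X) f c x :
  f \in gyr_subgroup (G:=G) -> alpha (f c) x = alpha c x.
Proof.
pose H := [pred f : symstar G | `[< forall c, alpha (f c) = alpha c >]].
move=> Rf; suff /asboolP -> : f \in H by [].
apply: generated_min Rf => [|g /asboolP[a [b ->]]]; last first.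
  by apply/asboolP => d; apply/funext => y; exact: act_gyr.
split=> [|g h /asboolP Hg /asboolP Hh]; apply/asboolP => // d.
(* For [g / h], write [d] as [h (h^-1 d)]. *)
by rewrite symstarME Hg -[in RHS](symstarKV h d) Hh.
Qed.

Lemma gs1M (p q : gsym G) : gs1 (p * q) = gs1 p * gs2 p (gs1 q).
Proof. by []. Qed.

Lemma GR_action_ex (alpha : action G X) :
  exists beta : action (GR G) X, forall p x, beta p x = alpha (gs1 (val p)) x.
Proof.
pose f (p : GR G) := alpha (gs1 (val p)).
have f1 x : f 1 x = x by exact: act1.
have fM p q x : f (p * q) x = f p (f q x).
  (* The first coordinate of [p * q] twists that of [q] by [gs2 p], an element of R(G). *)
  by rewrite /f valM gs1M actM act_gyr_subgroup //; exact: (valP p).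
by exists (Action f1 fM).
Qed.

Lemma completion_action_ex (alpha : action G X) :
  exists beta : action (completion G) X, forall a x, beta (nu a) x = alpha a x.
Proof.
have [beta betaE] := GR_action_ex alpha.
have /quot_action_ex [gamma gammaE] :
    {subset (R_closure G : {pred GR G}) <= act_kernel beta}.
  (* It suffices to treat the generators of [R(G)]; their first coordinate is [1]. *)
  apply: normal_closure_act_kernel => p /asboolP p1.
  by apply/asboolP => x; rewrite betaE p1 act1.
by exists gamma => a x; rewrite gammaE betaE.
Qed.

Lemma pi_completion (p : GR G) :
  \pi_(quot (R_closure G)) p = nu (gs1 (val p)).
Proof.
apply/quot_eqP/sub_normal_closure/asboolP.
(* [gs1 (r * s)] depends on [s] only through [gs1 s]. *)
by rewrite valM gmulfV -[LHS]/(gs1 ((val p)^-1 * val p)) mulVg.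
Qed.

Lemma nu_surj (m : completion G) : exists a, m = nu a.
Proof. by elim/quotW: m => p; rewrite pi_completion; eexists. Qed.

Lemma nu1 : nu (1 : G) = 1.
Proof. exact: (esym (pi_completion 1)). Qed.

(** In GR(G) the product of (a, I) and (b, I) is (a b, gyr[a,b]); passing to the coset discards the
    gyration. *)
Lemma nuM : {morph @nu G : a b / a * b}.
Proof. by move=> a b; rewrite /nu [RHS]quot_mulE [RHS]pi_completion. Qed.

Definition nu_pullback (beta : action (completion G) X) : action G X.
Proof.
exists (fun a => beta (nu a)) => [x | a b x]; first by rewrite nu1 act1.
by rewrite nuM actM.
Defined.

End CompletionAction.

Theorem theorem3p3 (G : gyrogroupType) (X : Type) (X_nonempty : inhabited X) :
  exists Phi : action G X -> action (completion G) X,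
    bijective Phi /\
    (forall (alpha : action G X) (a : G) (x : X),
       Phi alpha (nu a) x = alpha a x).
Proof.
(* Choosing an extension for each [alpha] is harmless: surjectivity of [nu] makes it unique. *)
have [Phi PhiE] := choice (@completion_action_ex G X).
exists Phi; split=> //; exists (@nu_pullback G X) => alpha; apply: actionP.
  by move=> a x; exact: PhiE.
by move=> m x; have [a ->] := nu_surj m; rewrite PhiE.
Qed.
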